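(* Let $a\ge 1$ be an integer and let $f_0:\{1,2,3,\ldots\}\to\mathbb{Z}$ be defined by $f_0(1)=1$, $f_0(2)=a$, and $f_0(n+2)=(a-1)f_0(n+1)$ for $n\ge 1$. Then for every $n\ge 1$, the number $f_0(n)$ is the number of words of length $n-1$ over the alphabet $\{0,1,\ldots,a-1\}$ such that no two adjacent letters are the same.
   Context: The empty word is the unique word of length $0$. *)

(* Defs.v *)
From mathcomp Require Import all_boot all_order all_algebra.

Set Implicit Arguments.
Unset Strict Implicit.
Unset Printing Implicit Defensive.

Definition no_adjacent_equal (T : eqType) (w : seq T) : bool :=
  sorted [rel x y | x != y] w.

(* [path.sorted] only compares consecutive entries, so it is meaningful for
   the non-transitive relation [!=]; here is the same condition by indices. *)
Lemma no_adjacent_equalP (T : eqType) (x0 : T) (w : seq T) :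
  reflect (forall i, i.+1 < size w -> nth x0 w i != nth x0 w i.+1)
          (no_adjacent_equal w).
Proof. exact: (sortedP x0). Qed.

(* Words of length m over {0, ..., a - 1}, the alphabet being ['I_a]; for
   m = 0 the type [0.-tuple 'I_a] contains only the empty word. *)
Definition words_no_adjacent_equal (a m : nat) : {set m.-tuple 'I_a} :=
  [set w : m.-tuple 'I_a | no_adjacent_equal w].

(* Main.v *)
Require Import Defs.
From mathcomp Require Import all_boot all_order all_algebra.

Set Implicit Arguments.
Unset Strict Implicit.
Unset Printing Implicit Defensive.

(** Put a letter [x] in front of a nonempty word [w] without adjacent
    repetitions: the result is again such a word exactly when [x] differs from
    the first letter of [w], so [w] has [a - 1] extensions over an alphabet of
    [a] letters ([card_no_adjacent_equalS]).  Every word with at least two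
    letters arises once in this way, which is the recurrence satisfied by the
    sequence.  The initial values count the empty word and the [a] one-letter
    words, and the claim follows by induction on the length. *)

(** Words of length at most one have no adjacent pair of letters, so all of
    them are counted. *)
Lemma card_no_adjacent_equal_small (T : finType) (m : nat) :
  m <= 1 -> #|[set w : m.-tuple T | no_adjacent_equal w]| = #|T| ^ m.
Proof.
move=> m_le1; rewrite -card_tuple; apply: eq_card => w; rewrite !inE.
have: size w <= 1 by rewrite size_tuple.
by case: (tval w) => [|x [|y s]].
Qed.

(** The number of letters that can be put in front of a nonempty word depends
    only on the alphabet, so the words of length [m.+2], fibred over their
    tails, have fibres of constant size [#|T|.-1].  The empty tail would admit
    all [#|T|] letters, whence the shift by two. *)
Lemma card_no_adjacent_equalS (T : finType) (m : nat) :
  #|[set w : m.+2.-tuple T | no_adjacent_equal w]|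
    = #|T|.-1 * #|[set w : m.+1.-tuple T | no_adjacent_equal w]|.
Proof.
pose consw (p : m.+1.-tuple T * T) := cons_tuple p.2 p.1.
have consw_bij : bijective consw.
  exists (fun w => (behead_tuple w, thead w)) => [[w x]|w].
    by congr (_, _); apply: val_inj.
  by apply: val_inj; rewrite [w in RHS]tuple_eta.
rewrite mulnC -[LHS]sum1_card (reindex consw); last exact: onW_bij.
rewrite -[X in X * _]sum1_card big_distrl /=.
transitivity (\sum_(w in [set w : m.+1.-tuple T | no_adjacent_equal w])
                \sum_(x | x != thead w) 1).
  rewrite pair_big_dep; apply: eq_bigl => -[w x] /=; rewrite !inE /=.
  by case/tupleP: w => y w; rewrite theadE andbC.
by apply: eq_bigr => w _; rewrite sum1_card mul1n -(cardC1 (thead w)).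
Qed.

Local Open Scope ring_scope.

Theorem proposition2 (a : nat) (ha : (1 <= a)%N) (f0 : nat -> int)
  (hf1 : f0 1%N = 1)
  (hf2 : f0 2%N = a%:Z)
  (hfrec : forall n : nat, (1 <= n)%N ->
    f0 (n + 2)%N = (a%:Z - 1) * f0 (n + 1)%N)
  (n : nat) (hn : (1 <= n)%N) :
  f0 n = #|words_no_adjacent_equal a (n - 1)|%:Z.
Proof.
case: n hn => // n _; rewrite subn1 /=.
elim: n => [|[|n] IHn].
- by rewrite hf1 card_no_adjacent_equal_small.
- by rewrite hf2 card_no_adjacent_equal_small // card_ord expn1.
rewrite -addn2 hfrec // addn1 IHn card_no_adjacent_equalS card_ord PoszM.
by rewrite -subn1 -subzn.
Qed.
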